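(* Let $q$ be a prime power, assume that $(n-1)\mid(q^2-1)$ and $1\le k\le\lfloor\frac{n+q-1}{q+1}\rfloor$. If $(n-1)\mid(k+1)(q+1)$ or $(n-1)\mid k(q+1)$, then for each $i\in\{1,2\}$ there exists a linear code $C$ with parameters $[n+2,k+2,\ge n-k]_{q^2}$ such that $\dim(\mathrm{Hull}_H(C))=k+2-i$.
   Context: $n,k$ are positive integers. An $[n,k,d]_{q^2}$ code is a linear code over $\mathbb{F}_{q^2}$ of length $n$, dimension $k$ and minimum Hamming distance $d$; $[n,k,\ge d_0]_{q^2}$ means that the minimum distance is at least $d_0$. The Hermitian inner product on $\mathbb{F}_{q^2}^n$ is $\langle x,y\rangle_H=\sum_i x_iy_i^q$, $C^{\perp_H}$ is the dual of $C$ with respect to it, and the Hermitian hull is $\mathrm{Hull}_H(C)=C\cap C^{\perp_H}$.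
   Formalization: The case n=2, i=1 (which forces k=1) is excluded: there C would have length 4 and dimension 3, so its Hermitian hull, contained in the 1-dimensional Hermitian dual, cannot have the claimed dimension 2. *)

(* Defs.v *)
From HB Require Import structures.
From mathcomp Require Import all_boot all_order all_algebra all_field.

Set Implicit Arguments.
Unset Strict Implicit.
Unset Printing Implicit Defensive.

Import Order.TTheory GRing.Theory.
Local Open Scope ring_scope.

Definition prime_power (q : nat) : Prop :=
  exists p m : nat, [/\ prime p, (0 < m)%N & q = (p ^ m)%N].

Section Codes.

Variables (F : finFieldType) (N : nat).
Implicit Types (x y : 'rV[F]_N) (C : {vspace 'rV[F]_N}).

Definition hamming_dist x y : nat := #|[set j : 'I_N | x 0 j != y 0 j]|.

(* A Hamming distance never exceeds N, so the default value N of the minimum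
   is only visible when C is the zero code. *)
Definition min_dist C : nat :=
  \big[Order.min/N]_(c : 'rV[F]_N * 'rV[F]_N
                | [&& c.1 \in C, c.2 \in C & c.1 != c.2])
    hamming_dist c.1 c.2.

Definition herm (q : nat) x y : F := \sum_(j < N) x 0 j * y 0 j ^+ q.

(* The vectors orthogonal to C already form a subspace (herm_dualP below); the
   span only gives it the type of a subspace. *)
Definition herm_dual (q : nat) C : {vspace 'rV[F]_N} :=
  <<enum [set x : 'rV[F]_N | [forall y, (y \in C) ==> (herm q x y == 0)]]%R>>%VS.

Definition herm_hull (q : nat) C : {vspace 'rV[F]_N} :=
  (C :&: herm_dual q C)%VS.

Lemma hamming_dist_le x y : (hamming_dist x y <= N)%N.
Proof. by rewrite -[leqRHS]card_ord max_card. Qed.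

Lemma min_dist_geP C (d : nat) : (d <= N)%N ->
  reflect {in C &, forall x y, x != y -> (d <= hamming_dist x y)%N}
          (d <= min_dist C)%N.
Proof.
move=> dN; apply: (iffP idP) => [le_d x y xC yC neq_xy | H].
  apply: leq_trans le_d _; rewrite -leEnat.
  by apply: (@bigmin_le_cond _ _ _ _ (x, y)); rewrite /= xC yC.
rewrite -leEnat; apply: le_bigmin => // -[x y] /= /and3P[xC yC].
exact: H.
Qed.

Lemma herm_dualP (q : nat) C x :
  reflect {in C, forall y, herm q x y = 0} (x \in herm_dual q C).
Proof.
apply: (iffP idP) => [|H]; last first.
  apply: memv_span; rewrite mem_enum inE; apply/forallP => y.
  by apply/implyP => yC; rewrite H.
move=> xD y yC; rewrite (coord_span (X := in_tuple _) xD) /herm.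
under eq_bigr do rewrite summxE mulr_suml.
rewrite exchange_big big1 //= => i _.
under eq_bigr do rewrite mxE -mulrA.
rewrite -mulr_sumr.
set z := _`_i; have : z \in enum
    [set x : 'rV[F]_N | [forall y, (y \in C) ==> (herm q x y == 0)]].
  by rewrite mem_nth.
rewrite mem_enum inE => /forallP/(_ y); rewrite yC /= => /eqP.
by rewrite /herm => ->; rewrite mulr0.
Qed.

End Codes.

(* Main.v *)
(** Put N = n - 1.  For N >= 3 evaluate the polynomials of degree at most k + 1
    at 0 and at the N-th roots of unity, scaling the coordinate at 0 by v with
    v^(q+1) = - N, and append two coordinates that only read the coefficients
    of X^k and X^(k+1).  The Hermitian product of the evaluations of X^r and
    X^s is N when N divides r + q s and 0 otherwise (also 0 for r = s = 0,
    thanks to v), and the arithmetic hypotheses leave only r = s = k and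
    r = s = k + 1 among the nonzero ones.  The monomials therefore give an
    orthogonal basis of the code, so the dimension of the hull is the number of
    isotropic monomials, and surjectivity of the norm F_(q^2) -> F_q lets the
    two extra coordinates choose which of X^k, X^(k+1) are isotropic.  For
    N <= 2 the hypotheses force k = 1, and short orthogonal bases are written
    down. *)
Require Import Defs.
From HB Require Import structures.
From mathcomp Require Import all_boot all_order all_algebra all_field.
From mathcomp Require Import cyclic zify.

Set Implicit Arguments.
Unset Strict Implicit.
Unset Printing Implicit Defensive.

(** * Divisibility conditions on pairs of exponents *)

Lemma dvdn_swap N q r s :
  0 < q -> N %| q ^ 2 - 1 -> N %| r + q * s -> N %| q * r + s.
Proof.
move=> q0 Nq Nrs.
(* As [q ^ 2] is 1 modulo [N], multiplying by [q] exchanges the roles of [r] and [s]. *)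
rewrite -(@dvdn_addl ((q ^ 2 - 1) * s)) ?dvdn_mulr //.
have -> : q * r + s + (q ^ 2 - 1) * s = q * (r + q * s).
  have : 0 < q ^ 2 by rewrite expn_gt0 q0.
  by rewrite mulnBl mul1n mulnDr mulnA mulnn; clear; nia.
exact: dvdn_mull.
Qed.

(** Gives the orthogonality of distinct monomials. If [r < s], then [N] also divides [q * r + s],
    hence the difference [(q - 1) * (s - r)]. The size bound on [k] leaves few cases, which [2 < N]
    or the divisibility alternative rules out. *)
Lemma dvdn_swap_eq N q k r s : 2 < N -> 1 < q -> N %| q ^ 2 - 1 ->
    0 < k -> k * (q + 1) <= N + q ->
    (N %| (k + 1) * (q + 1)) \/ (N %| k * (q + 1)) ->
  r <= k.+1 -> s <= k.+1 -> N %| r + q * s -> r = s.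
Proof.
move=> N2 q1 Nq k0 kN AB.
wlog lt_rs : r s / r < s => [th rk sk Nrs|_ sk Nrs].
  have [|lt|//] := ltngtP r s; first by move=> lt; apply: th.
  by apply/esym/th=> //; rewrite addnC; apply: dvdn_swap; rewrite // ltnW.
exfalso; have {Nq} := dvdn_swap (ltnW q1) Nq Nrs.
(* From here on [s = r + 1 + d], and soon [q = p + 2]. *)
rewrite -(subnKC lt_rs) in sk Nrs *;
  move: (s - r.+1) => d {lt_rs s} in sk Nrs *.
case: q q1 kN AB Nrs => [|[|p]] // _ kN AB Nrs Nsr.
have Nd : N %| p.+1 * d.+1.
  have e : r + p.+2 * (r.+1 + d) = p.+1 * d.+1 + (p.+2 * r + (r.+1 + d)).
    by clear; lia.
  by move: Nrs; rewrite e dvdn_addl.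
have {Nrs} leNd : N <= p.+1 * d.+1 by exact: dvdn_leq.
(* For [k = 1] the size bound is void, and the three pairs with [s <= 2] are settled by
   divisibility: for the pair (1, 2), [N] would divide both 3 and 4. *)
have [k1|k2] : k = 1 \/ 2 <= k by move: k0; clear; lia.
  subst k.
  have B : N %| 2 * (p.+2 + 1).
    by case: AB => // A; rewrite -[X in _ %| 2 * X]mul1n dvdn_mull.
  have [e|[e|e]] : (r = 0 /\ d = 0) \/ (r = 0 /\ d = 1) \/ (r = 1 /\ d = 0).
  - by move: sk; clear; lia.
  - by case: e Nsr N2 => -> ->; rewrite muln0 dvdn1 => /eqP->.
  - by case: e Nsr N2 => -> ->; rewrite muln0 ltnNge => /dvdn_leq->.
  case: e Nsr Nd => -> -> Nsr Nd.
  have N3 : N %| 3.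
    by rewrite -(@dvdn_addr (p.+1 * 1)) //; move: Nsr; congr (_ %| _); clear;
      lia.
  have N4 : N %| 4.
    rewrite -(@dvdn_addr (p.+1 * 1 * 2)) ?(dvdn_mulr 2 Nd) //.
    by move: B; congr (_ %| _); clear; lia.
  by have := dvdn_sub N4 N3; rewrite dvdn1 => /eqP N1; rewrite N1 in N2.
(* For [k >= 2], twice [N] exceeds [q * k + k + 1], the largest possible value of this sum, so the
   quotient is 1. *)
have NE : N = p.+2 * r + (r.+1 + d).
  case/dvdnP: Nsr => -[|[|m]] e; first by move: e; clear; lia.
    by rewrite e mul1n.
  have : 2 * N <= p.+2 * r + (r.+1 + d) by rewrite e leq_mul2r orbT.
  have : p.+2 * r <= p.+2 * k by rewrite leq_mul2l; move: sk; clear; lia.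
  have : 2 * (p.+2 + 1) <= k * (p.+2 + 1) by rewrite leq_mul2r k2 orbT.
  by move: kN sk; clear; lia.
clear Nsr Nd.
(* Since [r + d <= k], having [d >= 2] would push [k * (q + 1)] above [N + q]. *)
have d1 : d <= 1.
  rewrite leqNgt; apply/negP => d2.
  have : (r + d) * (p.+2 + 1) <= k * (p.+2 + 1).
    by rewrite leq_mul2r; move: sk; clear; lia.
  have : 2 * p.+2 <= d * p.+2 by rewrite leq_mul2r d2.
  move: kN; rewrite NE; clear -d2; nia.
(* Comparing [N = (q + 1) * r + d + 1] with [N <= (q - 1) * (d + 1)] and [2 < N] leaves only
   [r = d = 1]. Then [N = q + 3 >= 8] and [k = 2], and the alternative makes [N] divide 6 or 4. *)
have [d0|{}d1] : d = 0 \/ d = 1 by move: d1; clear; lia.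
  subst d; case: r => [|r] in NE leNd sk *; move: N2 NE leNd; clear; nia.
subst d; case: r => [|[|r]] in NE leNd sk *; first by move: N2 NE; clear; lia.
  have k_2 : k = 2.
    apply/eqP; rewrite eqn_leq k2 leqNgt andbT; apply/negP => k3.
    have : 3 * (p.+2 + 1) <= k * (p.+2 + 1) by rewrite leq_mul2r k3 orbT.
    by move: kN; rewrite NE; clear; lia.
  subst k; have N8 : 8 <= N by move: NE leNd; clear; lia.
  case: AB => AB.
    suff h : N %| 6 by have := @dvdn_leq N 6 isT h; move: N8; clear; lia.
    rewrite -(@dvdn_addr ((2 + 1) * (p.+2 + 1))) //.
    by rewrite (_ : _ + 6 = 3 * N) ?dvdn_mull // NE; clear; lia.
  suff h : N %| 4 by have := @dvdn_leq N 4 isT h; move: N8; clear; lia.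
  rewrite -(@dvdn_addr (2 * (p.+2 + 1))) //.
  by rewrite (_ : _ + 4 = 2 * N) ?dvdn_mull // NE; clear; lia.
by move: NE leNd; clear; nia.
Qed.

(** Here [r * (q + 1)] is positive and at most [(k - 1) * (q + 1) < N]. *)
Lemma ndvdn_diag N q k r : k * (q + 1) <= N + q -> 0 < r < k ->
  ~~ (N %| r * (q + 1)).
Proof.
move=> kN /andP[r0 rk]; apply/negP => /dvdn_leq.
rewrite muln_gt0 r0 addn1 => /(_ isT).
have := leq_mul rk (leqnn (q + 1)).
move: kN; clear; lia.
Qed.

Import Order.TTheory GRing.Theory.
Local Open Scope ring_scope.

(** * Primitive elements, the q-th power map and the norm of F_(q^2) *)

Lemma finField_prim_root (F : finFieldType) :
  exists z : F, (#|F|.-1).-primitive_root z.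
Proof.
pose rs := enum [pred x : F | x != 0].
have szrs : size rs = #|F|.-1 by rewrite -cardE cardC1.
have F1 := finNzRing_gt1 F.
have : has (#|F|.-1).-primitive_root rs.
  apply: cyclic.has_prim_root; rewrite ?enum_uniq ?szrs //.
    by rewrite -subn1 subn_gt0.
  apply/allP => x; rewrite mem_enum inE => x0; rewrite unity_rootE.
  rewrite -(inj_eq (mulfI x0)) -exprS prednK ?mulr1 ?expf_card //.
  exact: ltnW.
by case/hasP => z _ zP; exists z.
Qed.

Lemma prim_root_neq0 (R : nzRingType) n (z : R) : n.-primitive_root z -> z != 0.
Proof.
move=> zP; apply/eqP => z0; have /eqP := prim_expr_order zP.
by rewrite z0 expr0n gtn_eqF ?(prim_order_gt0 zP) // eq_sym oner_eq0.
Qed.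

Section QthPower.

Variables (F : finFieldType) (q : nat).
Hypotheses (q_pp : prime_power q) (cardF : #|F| = (q ^ 2)%N).

Lemma prime_power_gt1 : (1 < q)%N.
Proof.
by case: q_pp => p [m [pp m0 ->]]; rewrite -(exp1n m) ltn_exp2r // prime_gt1.
Qed.

Lemma exprD_q (x y : F) : (x + y) ^+ q = x ^+ q + y ^+ q.
Proof.
case: q_pp => p [m [pp m0 qE]]; apply: exprDn_pchar.
rewrite qE pnatX pnatE //; apply/orP; left.
by apply: (@card_finPcharP _ _ (m * 2)); rewrite // cardF qE expnM.
Qed.

Lemma expr_sum_q I (r : seq I) (P : pred I) (f : I -> F) :
  (\sum_(i <- r | P i) f i) ^+ q = \sum_(i <- r | P i) f i ^+ q.
Proof.
apply: (big_morph (fun x : F => x ^+ q)); first exact: exprD_q.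
by rewrite expr0n -[q]prednK // ltnW // prime_power_gt1.
Qed.

Lemma exprN_q (x : F) : (- x) ^+ q = - x ^+ q.
Proof.
apply/eqP; rewrite -addr_eq0 -exprD_q addNr expr0n.
by rewrite gtn_eqF // ltnW // prime_power_gt1.
Qed.

Lemma natr_q n : n%:R ^+ q = n%:R :> F.
Proof.
rewrite -[n]card_ord -sumr_const expr_sum_q.
by apply: eq_bigr => i _; rewrite expr1n.
Qed.

Lemma card_units : (#|F|.-1 = q.-1 * q.+1)%N.
Proof. by rewrite cardF -subn1 -(exp1n 2) subn_sqr subn1 addn1. Qed.

(** Write [c = z ^+ i] with [z] primitive of order [(q - 1) * (q + 1)]; then [c ^+ q.-1 = 1] forces
    [q + 1] to divide [i]. *)
Lemma norm_surj (c : F) : c != 0 -> c ^+ q = c -> exists x, x ^+ q.+1 = c.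
Proof.
have q1 := prime_power_gt1.
move=> c0 cq; have [z zP] := finField_prim_root F.
have cF : c ^+ q.-1 = 1.
  by apply: (mulfI c0); rewrite -exprS prednK ?mulr1 // ltnW.
have [|i ci] := prim_rootP zP (x := c);
  first by rewrite card_units exprM cF expr1n.
have : (q.+1 %| i)%N.
  rewrite -(@dvdn_pmul2l q.-1) -?card_units; last by rewrite -subn1 subn_gt0.
  by rewrite (prim_order_dvd zP) mulnC exprM -ci cF.
by case/dvdnP => m im; exists (z ^+ m); rewrite -exprM -im ci.
Qed.

(** For [q > 2] there are two distinct nonzero norms: 1, and the norm of a primitive element, which
    has order [q - 1 > 1]. *)
Lemma ex_norm_neq (c : F) : (2 < q)%N -> exists2 b : F, b != 0 & b ^+ q.+1 != c.
Proof.
move=> q2; have [<-|c1] := eqVneq 1 c; last first.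
  by exists 1; rewrite ?oner_eq0 ?expr1n.
have [z zP] := finField_prim_root F.
exists z; first exact: prim_root_neq0 zP.
rewrite -(prim_order_dvd zP) card_units; apply/negP => /(dvdn_leq (ltn0Sn _)).
by rewrite -[leqRHS]mul1n leq_mul2r /= leqNgt -subn1 ltn_subRL q2.
Qed.

(** * Codes spanned by a Hermitian-orthogonal family *)

Section Codes.

Variable N : nat.
Implicit Types x y : 'rV[F]_N.

Lemma herm_suml I (r : seq I) (c : I -> F) (b : I -> 'rV[F]_N) y :
  herm q (\sum_(i <- r) c i *: b i) y = \sum_(i <- r) c i * herm q (b i) y.
Proof.
rewrite /herm; under eq_bigr do rewrite summxE mulr_suml.
rewrite exchange_big; apply: eq_bigr => i _; rewrite mulr_sumr.
by apply: eq_bigr => j _; rewrite mxE mulrA.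
Qed.

Lemma herm_sumr I (r : seq I) (c : I -> F) (b : I -> 'rV[F]_N) x :
  herm q x (\sum_(i <- r) c i *: b i) = \sum_(i <- r) c i ^+ q * herm q x (b i).
Proof.
rewrite /herm; under eq_bigr do rewrite summxE expr_sum_q mulr_sumr.
rewrite exchange_big; apply: eq_bigr => i _; rewrite mulr_sumr.
by apply: eq_bigr => j _; rewrite mxE exprMn mulrCA.
Qed.

(** The weight bound yields freeness, as [0 < d], and the minimum distance. Pairing a hull vector
    with [b i] leaves [u i * herm q (b i) (b i)], so only isotropic basis vectors can occur in it;
    conversely these are orthogonal to the whole basis. *)
Lemma orthogonal_family_code m d (b : 'I_m -> 'rV[F]_N) :
    (0 < d <= N)%N ->
    (forall u : 'I_m -> F, (exists i, u i != 0) ->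
      (d <= #|[set j | ((\sum_i u i *: b i) 0 j != 0)%R]|)%N) ->
    (forall i j, i != j -> herm q (b i) (b j) = 0) ->
  exists C : {vspace 'rV[F]_N},
    [/\ \dim C = m, (d <= min_dist C)%N
      & \dim (herm_hull q C) = #|[pred i | herm q (b i) (b i) == 0]|].
Proof.
move=> /andP[d0 dN] wt orth; pose X := [tuple b i | i < m].
have XE (i : 'I_m) : X`_i = b i by rewrite -tnth_nth tnth_mktuple.
have memX x : x \in <<X>>%VS -> exists u : 'I_m -> F, x = \sum_i u i *: b i.
  move=> /coord_span ->; exists (fun i => coord X i x).
  by apply: eq_bigr => i _; rewrite XE.
have freeX : free X.
  apply/freeP => u; under eq_bigr do rewrite XE.
  move=> u0 i; apply/eqP; apply: contraLR d0 => ui; rewrite -leqNgt.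
  apply: leq_trans (wt u (ex_intro _ i ui)) _; rewrite u0 leqn0 cards_eq0.
  by apply/eqP/setP => j; rewrite !inE mxE eqxx.
have memb i : b i \in <<X>>%VS.
  by apply: memv_span; rewrite -XE mem_nth // size_tuple.
exists <<X>>%VS; split.
- by have := freeX; rewrite /free size_tuple => /eqP.
- apply/min_dist_geP => // x y xX yX neq_xy.
  have [u uE] := memX _ (memvB xX yX).
  have /wt : exists i, u i != 0.
    apply/existsP; apply: contraNT neq_xy; rewrite negb_exists => /forallP u0.
    rewrite -subr_eq0 uE big1 // => i _; have := u0 i.
    by rewrite negbK => /eqP->; rewrite scale0r.
  rewrite -uE /hamming_dist; under eq_finset do rewrite !mxE subr_eq0.
  by [].
set p := fun x => herm q x x == 0.
have -> : herm_hull q <<X>> = <<filter p X>>%VS.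
  apply/eqP; rewrite eqEsubv; apply/andP; split.
    apply/subvP => x; rewrite memv_cap => /andP[/memX[u ->] /herm_dualP xD].
    apply: memv_suml => i _; have /eqP := xD _ (memb i).
    rewrite herm_suml (bigD1 i) //= big1 ?addr0; last first.
      by move=> j ji; rewrite orth ?mulr0.
    rewrite mulf_eq0 => /orP[/eqP->|bi0]; first by rewrite scale0r mem0v.
    apply/memvZ/memv_span; rewrite mem_filter {1}/p bi0 -XE mem_nth //.
    by rewrite size_tuple.
  apply/span_subvP => x; rewrite mem_filter memv_cap => /andP[px xX].
  rewrite memv_span //=; apply/herm_dualP => y /memX[u ->].
  case/mapP: xX px => i _ -> /eqP px; rewrite herm_sumr big1 // => j _.
  by have [<-|/orth ->] := eqVneq i j; rewrite ?px mulr0.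
have := filter_free p freeX; rewrite /free => /eqP ->.
by rewrite size_filter count_map cardE -size_filter /enum_mem -enumT.
Qed.

End Codes.

End QthPower.

(** * Reed-Solomon codes on 0 and the N-th roots of unity, with two extra coordinates *)

Section ExtendedReedSolomon.

Variables (F : finFieldType) (N : nat) (z v : F) (l1 l2 : nat -> F).
Hypotheses (zP : N.-primitive_root z) (v0 : v != 0).

(** Index 0 is reserved for the point 0, so the roots of unity run from [z ^+ 1] to [z ^+ N = 1]. *)
Definition eval_pt (j : 'I_N.+1) : F := if j == 0%N :> nat then 0 else z ^+ j.

Definition eval_wt (j : 'I_N.+1) : F := if j == 0%N :> nat then v else 1.

(** As [0 ^+ 0 = 1], the coordinate at the point 0 is [v] for [r = 0] and vanishes for [r > 0]. *)
Definition ers_row (r : nat) : 'rV[F]_(N.+1 + 2) :=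
  row_mx (\row_j (eval_wt j * eval_pt j ^+ r))
         (\row_j (if j == 0%N :> nat then l1 r else l2 r)).

Lemma eval_pt_inj : injective eval_pt.
Proof.
have z0 := prim_root_neq0 zP; have N0 := prim_order_gt0 zP.
move=> i j; rewrite /eval_pt.
case: eqP => [i0|/eqP i0]; case: eqP => [j0|/eqP j0].
- by move=> _; apply: ord_inj; rewrite i0 j0.
- by move/esym/eqP; rewrite expf_eq0 (negPf z0) andbF.
- by move/eqP; rewrite expf_eq0 (negPf z0) andbF.
case: i j i0 j0 => -[|i] // iN [[|j] // jN] _ _ /=.
rewrite !exprS => /(mulfI z0)/eqP; rewrite (eq_prim_root_expr zP).
by rewrite !modn_small // => /eqP ij; apply: val_inj; rewrite /= ij.
Qed.

(** A geometric sum: its product with [z ^+ t - 1] is zero because [z ^+ N = 1]. *)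
Lemma sum_unity_roots t :
  \sum_(j < N) z ^+ (j.+1 * t) = if (N %| t)%N then N%:R else 0.
Proof.
have zt (j : nat) : z ^+ (j.+1 * t) = z ^+ t * (z ^+ t) ^+ j.
  by rewrite mulnC exprM exprS.
under eq_bigr do rewrite zt; rewrite -mulr_sumr (prim_order_dvd zP).
have [->|zt1] := eqVneq.
  by rewrite mul1r; under eq_bigr do rewrite expr1n;
    rewrite sumr_const card_ord.
have := subrX1 (z ^+ t) N; rewrite exprAC (prim_expr_order zP) expr1n subrr.
move/esym/eqP; rewrite mulf_eq0 subr_eq0 (negPf zt1) => /eqP->.
by rewrite mulr0.
Qed.

Lemma herm_ers_row q r s : (0 < q)%N ->
  herm q (ers_row r) (ers_row s) =
    (if (r == 0%N) && (s == 0%N) then v ^+ q.+1 else 0)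
    + (if (N %| r + q * s)%N then N%:R else 0)
    + l1 r * l1 s ^+ q + l2 r * l2 s ^+ q.
Proof.
move=> q0; rewrite /herm big_split_ord /= [X in _ + X]big_ord_recl big_ord1.
under eq_bigr do rewrite !row_mxEl !mxE.
rewrite !row_mxEr !mxE /= addrA; congr (_ + _ + _).
rewrite big_ord_recl; congr (_ + _).
  rewrite /eval_wt /eval_pt /= !expr0n.
  case: (r =P 0%N) => [_|_]; rewrite ?mulr0 ?mul0r //= mulr1.
  case: (s =P 0%N) => [_|_]; rewrite ?mulr0 ?mulr1 -?exprS //.
  by rewrite expr0n gtn_eqF // mulr0.
rewrite -sum_unity_roots; apply: eq_bigr => j _; rewrite /eval_wt /eval_pt /=.
by rewrite !mul1r -!exprM -exprD -mulnDr [(s * q)%N]mulnC.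
Qed.

(* A polynomial of degree k + 1 may have one root too many, but then its
   leading coefficient makes the last coordinate nonzero. *)
Lemma ers_weight k (u : 'I_k.+2 -> F) :
    (k <= N)%N -> (forall r, (l2 r == 0) = (r != k.+1)) ->
    (exists i, u i != 0) ->
  (N.+1 - k <= #|[set j | ((\sum_i u i *: ers_row i) 0 j != 0)%R]|)%N.
Proof.
move=> kN l2E [i0 ui0]; set x := \sum_i _.
pose f := \poly_(r < k.+2) u (inord r).
have fE (i : 'I_k.+2) : f`_i = u i by rewrite coef_poly ltn_ord inord_val.
have f0 : f != 0.
  by apply: contraNneq ui0 => f0; rewrite -fE f0 coef0.
have xl j : x 0 (lshift 2 j) = eval_wt j * f.[eval_pt j].
  rewrite summxE horner_poly mulr_sumr; apply: eq_bigr => i _.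
  by rewrite mxE row_mxEl mxE inord_val mulrCA.
have xr : x 0 (rshift N.+1 ord_max) = u ord_max * l2 k.+1.
  rewrite summxE (bigD1 ord_max) //= big1 ?addr0 => [|i ik].
    by rewrite mxE row_mxEr mxE.
  rewrite mxE row_mxEr mxE /=; have /eqP-> : l2 i == 0 by rewrite l2E.
  by rewrite mulr0.
have wt0 j : eval_wt j != 0 by rewrite /eval_wt; case: ifP => // _;
  apply: oner_neq0.
set S := [set j | _].
pose Z := [set j | f.[eval_pt j] == 0].
have ltZ : (#|Z| < size f)%N.
  have := @max_poly_roots _ f (map eval_pt (enum Z)) f0.
  rewrite size_map -cardE; apply.
    by apply/allP => y /mapP[j]; rewrite mem_enum inE => fj ->.
  by rewrite map_inj_uniq ?enum_uniq //; apply: eval_pt_inj.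
have cardZ : (#|Z| + #|~: Z| = N.+1)%N by rewrite cardsC card_ord.
have subS : lshift 2 @: (~: Z) \subset S.
  by apply/subsetP => y /imsetP[j]; rewrite !inE => fj ->; rewrite xl mulf_neq0.
have cardI : #|lshift 2 @: (~: Z)| = #|~: Z| by rewrite card_imset //;
  apply: lshift_inj.
(* In the first case [f] has degree at most [k], and the evaluation coordinates alone give the
   weight. *)
have [uk|uk] := eqVneq (u ord_max) 0.
  rewrite leq_subLR -[leqLHS]cardZ leq_add //;
    last by rewrite -cardI subset_leq_card.
  rewrite -ltnS (leq_trans ltZ) //; apply/leq_sizeP => j.
  rewrite leq_eqVlt => /orP[/eqP<-|kj];
    last by rewrite nth_default // (leq_trans (size_poly _ _)).
  by rewrite (fE ord_max).
rewrite leq_subLR -[leqLHS]cardZ.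
have ltZk : (#|Z| < k.+2)%N by apply: leq_trans ltZ (size_poly _ _).
have : (rshift N.+1 (ord_max : 'I_2)) |: lshift 2 @: (~: Z) \subset S.
  by rewrite subUset subS sub1set inE xr mulf_neq0 // l2E eqxx.
move=> /subset_leq_card; rewrite cardsU1 cardI => leS.
have notin : (rshift N.+1 (ord_max : 'I_2)) \notin lshift 2 @: (~: Z).
  by apply/imsetP => -[j _ /eqP]; rewrite eq_rlshift.
move: leS; rewrite notin add1n => leS.
by rewrite (leq_trans _ (leq_add (leqnn k) leS)) // addnS -addSn leq_add2r.
Qed.

End ExtendedReedSolomon.

(** * Prescribing the hull dimension when N is at least 3 *)

Section Existence.

Variables (F : finFieldType) (q : nat).
Hypotheses (q_pp : prime_power q) (cardF : #|F| = (q ^ 2)%N).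

Lemma norm_oppr_nat n : n%:R != 0 :> F ->
  exists2 x : F, x != 0 & x ^+ q.+1 = - n%:R.
Proof.
move=> n0; have [||x xE] := norm_surj q_pp cardF (c := - n%:R).
- by rewrite oppr_eq0.
- by rewrite exprN_q // natr_q.
exists x => //; apply: contraNneq n0 => x0.
by rewrite -oppr_eq0 -xE x0 expr0n.
Qed.

Lemma natr_neq0 n : (n %| q ^ 2 - 1)%N -> n%:R != 0 :> F.
Proof.
move=> nq; have [z zP] := finField_prim_root F.
by apply: (prim_root_natf_neq0 (dvdn_prim_root zP _)); rewrite cardF -subn1.
Qed.

(** The first extra coordinate is [a] in row [k] and [c] in row [k + 1]; the second is [b] in row
    [k + 1] only. The condition [a * c = 0] keeps these rows orthogonal, and [b != 0] serves the
    weight bound. The two boolean summands record whether rows [k] and [k + 1] are isotropic. *)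
Lemma ers_code N k (a b c : F) : (2 < N)%N -> (N %| q ^ 2 - 1)%N ->
    (0 < k)%N -> (k * (q + 1) <= N + q)%N ->
    (N %| (k + 1) * (q + 1))%N \/ (N %| k * (q + 1))%N ->
    a * c = 0 -> b != 0 ->
  exists C : {vspace 'rV[F]_(N.+1 + 2)},
    [/\ \dim C = k.+2, (N.+1 - k <= min_dist C)%N
      & \dim (herm_hull q C) =
          (k + ((if (N %| k * (q + 1))%N then N%:R else 0) + a ^+ q.+1 == 0)%R
             + ((if (N %| (k + 1) * (q + 1))%N then N%:R else 0)
                + c ^+ q.+1 + b ^+ q.+1 == 0)%R)%N].
Proof.
move=> N2 Nq k0 kN AB ac b0; have q1 := prime_power_gt1 q_pp.
have q0 := ltnW q1.
have [z0 z0P] := finField_prim_root F.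
have zP : N.-primitive_root (z0 ^+ (#|F|.-1 %/ N)).
  by apply: (dvdn_prim_root z0P); rewrite cardF -subn1.
set z := z0 ^+ _ in zP.
have [v v0 vE] := norm_oppr_nat (prim_root_natf_neq0 zP).
pose l1 r := if r == k then a else if r == k.+1 then c else 0.
pose l2 r := if r == k.+1 then b else 0.
have kltN : (k <= N)%N.
  have : (k * 3 <= k * (q + 1))%N by rewrite leq_mul2l addn1 ltnS q1 orbT.
  have : (q <= k * q)%N by rewrite leq_pmull.
  by move: kN; clear; lia.
have l2E r : (l2 r == 0) = (r != k.+1).
  by rewrite /l2; case: (r =P _) => _; rewrite ?eqxx // (negPf b0).
have dNk : (0 < N.+1 - k <= N.+1 + 2)%N by move: kltN; clear; lia.
have [||C [dC wC hC]] := orthogonal_family_code (b := fun r : 'I_k.+2 =>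
  ers_row N z v l1 l2 r) q_pp cardF dNk.
- by move=> u u0; apply: ers_weight.
- move=> i j ij; rewrite herm_ers_row //.
  have -> : (i == 0%N :> nat) && (j == 0%N :> nat) = false.
    by apply: contraNF ij => /andP[/eqP i0 /eqP j0]; apply/eqP/ord_inj;
      rewrite i0 j0.
  rewrite ifF ?add0r; last first.
    apply: contraNF ij => d; apply/eqP/ord_inj.
    by apply: (dvdn_swap_eq N2 q1 Nq k0 kN AB _ _ d); rewrite -ltnS.
  have {}ij : i != j :> nat by [].
  have -> : l2 i * l2 j ^+ q = 0.
    rewrite /l2; case: eqP => [ik|_]; rewrite ?mul0r //.
    rewrite ifN ?expr0n ?(gtn_eqF q0) ?mulr0 //.
    by apply: contraNneq ij => jk; rewrite ik jk.
  have -> : l1 i * l1 j ^+ q = 0; last by rewrite addr0.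
  have c0 : a * c ^+ q = 0 by rewrite -[q]prednK // exprS mulrA ac mul0r.
  have c1 : c * a ^+ q = 0 by rewrite -[q]prednK // exprS mulrA (mulrC c) ac mul0r.
  move: ij; rewrite /l1.
  case: (i =P k :> nat) => [->|_]; last case: (i =P k.+1 :> nat) => [->|_];
  (case: (j =P k :> nat) => [->|_]; last case: (j =P k.+1 :> nat) => [->|_]);
  by rewrite ?eqxx ?mul0r ?expr0n ?(gtn_eqF q0) ?mulr0.
exists C; split=> //; rewrite hC -sum1_card big_mkcond /= !big_ord_recr /=.
have dE r : (r + q * r = r * (q + 1))%N by rewrite mulnDr muln1 mulnC addnC.
rewrite !inE !herm_ers_row // !dE /l1 /l2 !eqxx (gtn_eqF k0) /= !add0r.
rewrite (gtn_eqF (ltnSn k)) (ltn_eqF (ltnSn k)) mul0r !addr0.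
rewrite -!exprS [(k + 1)%N]addn1.
congr (_ + _ + _)%N; try by case: eqP.
(* The [k] rows below row [k] are all isotropic: row 0 by the choice of [v], the others by
   [ndvdn_diag]. *)
rewrite -[RHS]card_ord -sum1_card; apply: eq_bigr => i _.
rewrite !inE herm_ers_row // dE /= (ltn_eqF (ltn_ord i)).
rewrite (ltn_eqF (ltnW (ltn_ord i : i.+1 < k.+1)%N)).
rewrite !mul0r !addr0; case: (posnP i) => [i0|i0].
  by rewrite i0 mul0n dvdn0 vE addNr eqxx.
rewrite (negPf (ndvdn_diag kN (r := i) _)) ?i0 ?ltn_ord //.
by rewrite add0r eqxx.
Qed.

Lemma ers_code_hull_dim N k i : (2 < N)%N -> (N %| q ^ 2 - 1)%N ->
    (0 < k)%N -> (k * (q + 1) <= N + q)%N ->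
    (N %| (k + 1) * (q + 1))%N \/ (N %| k * (q + 1))%N ->
    (i = 1 \/ i = 2)%N ->
  exists C : {vspace 'rV[F]_(N.+1 + 2)},
    [/\ \dim C = k.+2, (N.+1 - k <= min_dist C)%N
      & \dim (herm_hull q C) = (k + 2 - i)%N].
Proof.
move=> N2 Nq k0 kN AB i12; have q1 := prime_power_gt1 q_pp.
have NF := natr_neq0 Nq.
have code a b c := ers_code N2 Nq k0 kN AB (a := a) (b := b) (c := c).
have one1 : 1 ^+ q.+1 = 1 :> F by rewrite expr1n.
have zero0 : 0 ^+ q.+1 = 0 :> F by rewrite expr0n.
have [x x0 xE] := norm_oppr_nat NF.
suff [a [b [c [ac b0 hE]]]] : exists a b c : F, [/\ a * c = 0, b != 0 &
    (((if (N %| k * (q + 1))%N then N%:R else 0) + a ^+ q.+1 == 0)%R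
     + ((if (N %| (k + 1) * (q + 1))%N then N%:R else 0)
         + c ^+ q.+1 + b ^+ q.+1 == 0)%R = 2 - i)%N].
  have [C [dC wC hC]] := code a b c ac b0.
  exists C; split=> //; rewrite hC -addnA hE addnBA //.
  by case: i12 => ->.
case: i12 => ->.
  (* Exactly one of the two rows must be isotropic: [x], of norm [- N%:R], cancels [N%:R] in one
     row, while the other row keeps the value [N%:R] or 1. *)
  case: ifP AB => A; case: ifP => B AB.
  - by exists 0, x, 0; rewrite mulr0 zero0 xE !addr0 subrr eqxx (negPf NF).
  - by exists x, 1, 0; rewrite mulr0 zero0 xE one1 !add0r subrr eqxx oner_eq0.
  - by exists 1, x, 0;
      rewrite mulr0 zero0 one1 xE add0r addr0 subrr eqxx oner_eq0.
  - by case: AB.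
case: ifP AB => A AB.
  (* Neither row may be isotropic. With [a = 0] row [k] has value [N%:R]; if [b = 1] and [c = 0]
     make row [k + 1] isotropic, then [c = 1] turns its value into 1. *)
  have [e|ne] := eqVneq ((if (N %| (k + 1) * (q + 1))%N then N%:R else 0) + 0 +
    1 : F) 0.
    exists 0, 1, 1; rewrite mul0r oner_eq0 zero0 one1 addr0 (negPf NF).
    by split=> //; move: e; rewrite addr0 => ->; rewrite add0r oner_eq0.
  exists 0, 1, 0; rewrite mul0r oner_eq0 zero0 one1 addr0 (negPf NF) addr0.
  by move: ne; rewrite addr0 => /negPf->.
(* For [q = 2], [N] divides [q ^ 2 - 1 = 3 = q + 1], contrary to [A]. *)
have q2 : (2 < q)%N.
  rewrite ltn_neqAle q1 andbT; apply/eqP => q2; move: Nq A.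
  by rewrite -q2 => N3; rewrite dvdn_mull.
have [b b0 bN] := ex_norm_neq cardF (- N%:R) q2.
exists 1, b, 0; rewrite mulr0 b0 one1 zero0 add0r oner_eq0 addr0.
case: AB => // ->; split=> //.
by rewrite addrC addr_eq0 (negPf bN).
Qed.

(** * Explicit orthogonal bases for N = 1 and N = 2 *)

Definition rows_of_seq m n (s : seq (seq F)) (i : 'I_m) : 'rV[F]_n :=
  \row_j (nth [::] s i)`_j.

(** The first basis vector is isotropic because [a] has norm -1; the two unit vectors are not. *)
Lemma code_of_length_4 : exists C : {vspace 'rV[F]_(2 + 2)},
  [/\ \dim C = 3, (1 <= min_dist C)%N & \dim (herm_hull q C) = 1]%N.
Proof.
have q0 := ltnW (prime_power_gt1 q_pp).
have [a a0 aE] := @norm_oppr_nat 1 (oner_neq0 _).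
pose b := @rows_of_seq 3 (2 + 2) [:: [:: 1; a; 0; 0]; [:: 0; 0; 1; 0]; [:: 0;
  0; 0; 1]].
have qF : (q == 0)%N = false by rewrite gtn_eqF.
have [//|||C [dC wC hC]] := orthogonal_family_code (b := b) (d := 1) q_pp cardF.
- move=> u [i ui]; apply/card_gt0P.
  (* A coordinate where row [i] has entry 1 and the other rows vanish. *)
  pose j : 'I_(2 + 2) := inord (nth 0%N [:: 0; 2; 3]%N i).
  exists j; rewrite inE summxE !big_ord_recl big_ord0 !mxE.
  case: i ui @j => -[|[|[|//]]] lti ui /=; rewrite inordK //=;
  rewrite ?(mulr0, mulr1, addr0, add0r);
  by move: ui; congr (u _ != 0); apply: ord_inj.
- case=> -[|[|[|//]]] lti [[|[|[|//]]] ltj] //= _;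
  rewrite /herm !big_ord_recl big_ord0 !mxE /=;
  by rewrite ?(expr0n, qF, expr1n, mulr0, mul0r, addr0).
exists C; split=> //; rewrite hC -sum1_card big_mkcond /=.
rewrite !big_ord_recl big_ord0 !inE /herm !big_ord_recl !big_ord0 !mxE /=.
rewrite !(expr0n, qF, expr1n, mulr0, mul0r, mul1r, mulr1, add0r, addr0).
by rewrite -exprS aE subrr eqxx oner_eq0.
Qed.

Lemma code_of_length_5 i : odd q -> (i = 1 \/ i = 2)%N ->
  exists C : {vspace 'rV[F]_(3 + 2)},
  [/\ \dim C = 3, (2 <= min_dist C)%N & \dim (herm_hull q C) = 3 - i]%N.
Proof.
move=> oddq i12; have q0 := ltnW (prime_power_gt1 q_pp).
have two0 : 2%:R != 0 :> F by apply: natr_neq0;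
  rewrite dvdn2 oddB ?expn_gt0 ?q0 // oddX oddq.
have [a a0 aE] := @norm_oppr_nat 1 (oner_neq0 _).
(* The second basis vector has value 2 plus the norm of [t]: norm -2 makes it isotropic, norm -1
   gives 1. The first vector is always isotropic, and the third has value 2, nonzero as [q] is
   odd. *)
have [t t0 tE] : exists2 t : F, t != 0 & (1 + (1 + t ^+ q.+1) == 0) = (i ==
  1%N).
  case: i12 => ->.
    have [t t0 tE] := norm_oppr_nat two0.
    by exists t => //; rewrite tE addrA -(natrD _ 1 1) subrr !eqxx.
  have [t t0 tE] := @norm_oppr_nat 1 (oner_neq0 _).
  by exists t => //; rewrite tE subrr addr0 oner_eq0.
pose b := @rows_of_seq 3 (3 + 2)
  [:: [:: 1; a; 0; 0; 0]; [:: 0; 0; 1; 1; t]; [:: 0; 0; 1; -1; 0]].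
have qF : (q == 0)%N = false by rewrite gtn_eqF.
have N1q : (-1) ^+ q = -1 :> F by rewrite exprN_q // expr1n.
have [//|||C [dC wC hC]] := orthogonal_family_code (b := b) (d := 2) q_pp cardF.
- move=> u [i0 ui]; apply/card_gt1P; set x := \sum_i _.
  have xE (j : 'I_5) : x 0 j = u ord0 * [:: 1; a; 0; 0; 0]`_j
      + (u (inord 1) * [:: 0; 0; 1; 1; t]`_j + u (inord 2) * [:: 0; 0; 1; -1;
        0]`_j).
    rewrite summxE !big_ord_recl big_ord0 !mxE addr0 /=.
    have -> : inord 1 = lift ord0 ord0 :> 'I_3 by apply: ord_inj;
      rewrite inordK.
    have -> : inord 2 = lift ord0 (lift ord0 ord0) :> 'I_3.
      by apply: ord_inj; rewrite inordK.
    by [].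
  have xS (j1 j2 : nat) : (j1 < 5)%N -> (j2 < 5)%N -> j1 != j2 ->
      x 0 (inord j1) != 0 -> x 0 (inord j2) != 0 ->
    exists x0 y, [/\ x0 \in [set j | x 0 j != 0], y \in [set j | x 0 j != 0] &
      x0 != y].
    move=> l1 l2 j12 x1 x2; exists (inord j1), (inord j2); rewrite !inE x1 x2.
    by split=> //; rewrite -val_eqE /= !inordK.
  have [u0|u0] := eqVneq (u ord0) 0; last first.
    by apply: (xS 0 1)%N;
      rewrite // xE inordK //= !mulr0 !addr0 ?mulr1 ?mulf_neq0.
  have [u1|u1] := eqVneq (u (inord 1)) 0.
    have u2 : u (inord 2) != 0.
      apply: contraNneq ui => u2; case: i0 => -[|[|[|//]]] lti.
      - by rewrite -[X in _ == X]u0; apply/eqP; congr u; apply: ord_inj.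
      - by rewrite -[X in _ == X]u1; apply/eqP; congr u; apply: ord_inj;
          rewrite inordK.
      - by rewrite -[X in _ == X]u2; apply/eqP; congr u; apply: ord_inj;
          rewrite inordK.
    by apply: (xS 2 3)%N;
      rewrite // xE inordK //= u0 u1 !mul0r !add0r ?mulr1 ?mulrN1 ?oppr_eq0.
  (* Besides this coordinate, one of coordinates 2 and 3 is nonzero: they are the sum and difference
     of [u (inord 1)] and [u (inord 2)], and 2 is invertible. *)
  have x4 : x 0 (inord 4) != 0.
    by rewrite xE inordK //= u0 mul0r mulr0 addr0 add0r mulf_neq0.
  have [e|?] := eqVneq (u (inord 1) + u (inord 2)) 0; last first.
    by apply: (xS 2 4)%N; rewrite // xE inordK //= u0 mul0r add0r !mulr1.
  apply: (xS 3 4)%N; rewrite // xE inordK //= u0 mul0r add0r mulr1 mulrN1.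
  move/eqP: e; rewrite addr_eq0 => /eqP e.
  by rewrite -e -mulr2n -mulr_natr mulf_neq0.
- case=> -[|[|[|//]]] lti [[|[|[|//]]] ltj] //= _;
  rewrite /herm !big_ord_recl big_ord0 !mxE /=;
  by rewrite ?(expr0n, qF, expr1n, N1q, mulr0, mul0r, mul1r, mulr1, addr0,
    add0r, subrr).
exists C; split=> //; rewrite hC -sum1_card big_mkcond /=.
rewrite !big_ord_recl big_ord0 !inE /herm !big_ord_recl !big_ord0 !mxE /=.
rewrite !(expr0n, qF, expr1n, N1q, mulr0, mul0r, mul1r, mulr1, add0r, addr0)
  mulrN1 opprK.
rewrite -!exprS aE subrr eqxx tE -(natrD _ 1 1) (negPf two0).
by case: i12 => ->.
Qed.

End Existence.

(* Case distinction on the number N of roots of unity *)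
Local Close Scope ring_scope.

(** For [n = 2] the bounds force [k = 1]. A code of length 4 and dimension 3 has a Hermitian dual of
    dimension 1, so its hull cannot have dimension 2; [hni] excludes this case. *)
Theorem theorem4 (q n k : nat) (F : finFieldType)
  (hq : prime_power q) (hF : #|F| = q ^ 2)
  (hn : 0 < n) (hnq : (n - 1) %| (q ^ 2 - 1))
  (hk : 1 <= k <= (n + q - 1) %/ (q + 1))
  (hdiv : ((n - 1) %| (k + 1) * (q + 1)) \/ ((n - 1) %| k * (q + 1)))
  (i : nat) (hi : i = 1 \/ i = 2)
  (hni : ~ (n = 2 /\ i = 1)) :
  exists C : {vspace 'rV[F]_(n + 2)},
    [/\ \dim C = k + 2,
        n - k <= min_dist C
      & \dim (herm_hull q C) = k + 2 - i].
Proof.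
have q1 := prime_power_gt1 hq.
case: n => [//|N] in hn hnq hk hdiv hni *.
rewrite subn1 /= in hnq hdiv; case/andP: hk => k0.
rewrite leq_divRL ?addn1 // -addn1 addSn subn1 /= => kN.
have [N2|N2] := ltnP 2 N.
  have [C [dC wC hC]] := ers_code_hull_dim hq hF N2 hnq k0 kN hdiv hi.
  by exists C; split=> //; rewrite dC addn2.
(* If [k >= 2], then [2 * (q + 1) <= N + q <= q + 2], which is absurd. *)
have k1 : k = 1.
  have := leq_mul (leqnn k) q1; case: k k0 kN {hdiv} => [|[|k]] //= _.
  by move: N2 q1; clear; nia.
(* [N = 0] cannot divide the positive number [q ^ 2 - 1], [N = 1] leaves [i = 2], and [N = 2] forces
   [q] to be odd. *)
subst k; case: N N2 {hn kN} hnq hdiv hni => [|[|[|//]]] _ hnq hdiv hni.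
- move: hnq; rewrite dvd0n subn_eq0 leqNgt.
  by rewrite -{1}(exp1n 2) ltn_exp2r // q1.
- have i2 : i = 2 by case: hi => // i1; case: hni.
  have [C [dC wC hC]] := code_of_length_4 hq hF.
  by exists C; rewrite dC hC i2.
have oddq : odd q.
  by move: hnq; rewrite dvdn2 oddB ?expn_gt0 ?(ltnW q1) // oddX; case: odd.
have [C [dC wC hC]] := code_of_length_5 hq hF oddq hi.
by exists C; rewrite dC hC.
Qed.
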